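(* Let $L$ be a probability interval on a finite set $X$, and let $\pi$ and $\pi_\delta$ be the two possibility distributions obtained from $L$ by the procedures described in the context. Then the cloud $[1-\pi_\delta,\pi]$ built from these two possibility distributions is such that its induced credal set outer-approximates $\mathcal{P}_L$, i.e. $\mathcal{P}_L\subseteq\mathcal{P}_{[1-\pi_\delta,\pi]}$. In the degenerate case where $L$ is a precise probability distribution, this cloud contains this distribution only (i.e. $\mathcal{P}_{[1-\pi_\delta,\pi]}$ consists of this single distribution).
   Context: $X$ is a finite set with $n$ elements and $\mathbb{P}_X$ is the set of probability measures on $X$. A cloud $[\delta,\pi]$ on $X$ is a pair of mappings $\delta,\pi:X\to[0,1]$ with $\delta\le\pi$ pointwise, $\pi(x)=1$ for at least one $x\in X$, and $\delta(y)=0$ for at least one $y\in X$. Its credal set is $$\mathcal{P}_{[\delta,\pi]}=\{P\in\mathbb{P}_X \mid \forall \alpha\in[0,1],\ P(\{x\in X\mid \delta(x)\ge\alpha\})\le 1-\alpha\le P(\{x\in X\mid \pi(x)>\alpha\})\}.$$ A possibility distribution on $X$ is a mapping $X\to[0,1]$ taking the value $1$ at least once. A probability interval $L$ on $X$ is a tuple of intervals $\{[l(x),u(x)]\mid x\in X\}$ enclosing the probabilities $p(x)$, $x\in X$. Its credal set $\mathcal{P}_L$ is the set of probability measures on $X$ with mass function $p$ satisfying $l(x)\le p(x)\le u(x)$ for all $x\in X$. The degenerate (precise) case is $l=u=p$ for a probability distribution $p$. $L$ induces a partial order $\le_L$ on $X$: $x\le_L y\iff u(x)\le l(y)$. Elements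 $x,y$ are incomparable if the intervals $[l(x),u(x)]$ and $[l(y),u(y)]$ intersect. $\mathcal{C}_L$ is the set of linear extensions of $\le_L$, i.e. linear orderings $<_l$ of $X$ compatible with $\le_L$. For $<_l\in\mathcal{C}_L$, $\sigma_l(x)\in\{1,\ldots,n\}$ denotes the rank of $x$ in $<_l$. Procedures. For each $<_l\in\mathcal{C}_L$ and each $x\in X$, set $$\pi^l(x)=\max_{p}\sum_{\sigma_l(y)\le\sigma_l(x)}p(y),\qquad \pi_\delta^l(x)=\max_{p}\sum_{\sigma_l(x)\le\sigma_l(y)}p(y),$$ where both maxima are over all $p=\{p(y)\mid y\in X\}$ satisfying the constraints $\sum_{x\in X}p(x)=1$, $l(x)\le p(x)\le u(x)$ for all $x\in X$, and $p(\sigma_l^{-1}(1))\le p(\sigma_l^{-1}(2))\le\ldots\le p(\sigma_l^{-1}(n))$. Then define $$\pi(x)=\max_{<_l\in\mathcal{C}_L}\pi^l(x),\qquad \pi_\delta(x)=\max_{<_l\in\mathcal{C}_L}\pi_\delta^l(x).$$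
   Formalization: The claim for a precise distribution is proved only when no element of positive probability shares its probability with another element; with such ties it fails (for p=(1/2,1/2) the cloud is [0,1], whose credal set contains every distribution). *)

(* Defs.v *)
From mathcomp Require Import all_boot all_order all_algebra.
From mathcomp Require Import boolp classical_sets reals.

Set Implicit Arguments.
Unset Strict Implicit.
Unset Printing Implicit Defensive.

Import Order.TTheory GRing.Theory Num.Theory.
Local Open Scope classical_set_scope.
Local Open Scope ring_scope.

(* A probability measure on the finite set X is given by its mass function. *)
Definition prob_measures (R : realType) (X : finType) : set (X -> R) :=
  [set p | (forall x, 0 <= p x) /\ \sum_x p x = 1].

Definition Pr (R : realType) (X : finType) (p : X -> R) (A : pred X) : R :=
  \sum_(x | A x) p x.

Definition is_cloud (R : realType) (X : finType) (delta pi : X -> R) : Prop :=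
  [/\ forall x, 0 <= delta x <= 1,
      forall x, 0 <= pi x <= 1,
      forall x, delta x <= pi x,
      exists x, pi x = 1
    & exists y, delta y = 0].

Definition cloud_credal (R : realType) (X : finType) (delta pi : X -> R) :
    set (X -> R) :=
  [set p | prob_measures p /\
    forall alpha : R, 0 <= alpha <= 1 ->
      Pr p [pred x | delta x >= alpha] <= 1 - alpha
        <= Pr p [pred x | pi x > alpha]].

Definition interval_credal (R : realType) (X : finType) (l u : X -> R) :
    set (X -> R) :=
  [set p | prob_measures p /\ forall x, l x <= p x <= u x].

(* The intervals enclose the masses of at least one probability measure: without
   this the maxima defining the two possibility distributions do not exist. *)
Definition prob_interval (R : realType) (X : finType) (l u : X -> R) : Prop :=
  (forall x, 0 <= l x /\ l x <= u x /\ u x <= 1) /\ interval_credal l u !=set0.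

Definition le_L (R : realType) (X : finType) (l u : X -> R) : rel X :=
  fun x y => u x <= l y.

(* le_L is antisymmetric unless two distinct elements carry the same one-point
   interval; such elements are mutually related and, their intervals meeting,
   count as incomparable. Hence compatibility is with the strict part of le_L;
   when le_L is antisymmetric, this is the same as compatibility with le_L. *)
Definition lt_L (R : realType) (X : finType) (l u : X -> R) : rel X :=
  fun x y => le_L l u x y && ~~ le_L l u y x.

(* A linear ordering is represented by its reflexive relation. *)
Definition linear_extensions (R : realType) (X : finType) (l u : X -> R) :
    set (rel X) :=
  [set r | [/\ total r, antisymmetric r, transitive r
             & forall x y, lt_L l u x y -> r x y]].

(* For a linear ordering, ranks run from 1 to #|X|. *)
Definition rank (X : finType) (r : rel X) (x : X) : nat := #|[pred y | r y x]|.

Definition feasible (R : realType) (X : finType) (l u : X -> R) (r : rel X) :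
    set (X -> R) :=
  [set p | [/\ \sum_x p x = 1,
               forall x, l x <= p x <= u x
             & forall x y, (rank r x <= rank r y)%N -> p x <= p y]].

(* The suprema below are maxima: of a linear form over a compact polytope in
   pi_l and pi_delta_l, of finitely many values in pi_L and pi_delta_L.
   Some linear extensions may have no feasible p; as sup set0 = 0 and all other
   values are nonnegative, these do not affect pi_L and pi_delta_L. *)
Definition pi_l (R : realType) (X : finType) (l u : X -> R) (r : rel X)
    (x : X) : R :=
  sup [set Pr p [pred y | (rank r y <= rank r x)%N] | p in feasible l u r].

Definition pi_delta_l (R : realType) (X : finType) (l u : X -> R) (r : rel X)
    (x : X) : R :=
  sup [set Pr p [pred y | (rank r x <= rank r y)%N] | p in feasible l u r].

Definition pi_L (R : realType) (X : finType) (l u : X -> R) (x : X) : R :=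
  sup [set pi_l l u r x | r in linear_extensions l u].

Definition pi_delta_L (R : realType) (X : finType) (l u : X -> R) (x : X) : R :=
  sup [set pi_delta_l l u r x | r in linear_extensions l u].

Definition delta_L (R : realType) (X : finType) (l u : X -> R) (x : X) : R :=
  1 - pi_delta_L l u x.

(* Main.v *)
Require Import Defs.
From mathcomp Require Import all_boot all_order all_algebra.
From mathcomp Require Import boolp classical_sets reals.
From mathcomp Require Import lra.

(** Every p between l and u can be listed increasingly in an order compatible
    with the intervals: sort by p, and break ties by the midpoint, that is by l + u, since
    two comparable intervals that both contain the tied value are ordered by
    their midpoints ([mass_order_extension]).  For that order p is itself
    feasible in the optimisation problems defining pi and pi_delta, so
    P(elements ranked up to x) <= pi x  and
    P(elements ranked from x on) <= pi_delta x  for every x.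

    The rest of the first part only uses these two families of inequalities and
    the bound 1 on pi and pi_delta.
    A sublevel set of pi_delta is contained in the up-set of its lowest-ranked
    element, whence P(pi_delta <= c) <= c, and dually for pi
    ([Pr_sublevel_le]); these are the constraints of the credal set.  Taking the
    extreme elements of the order, whose up-set or down-set is everything, gives
    the normalisation of the cloud, and delta <= pi holds because the down-set
    and the up-set of x cover X.

    When l = u = p, the distribution p is the only candidate in the
    maximisations, and it is monotone in the rank; hence pi x <= P(p <= p x)
    and pi_delta x <= P(p >= p x).  Taking alpha = P(p <= p x) in the lower
    constraint on a member q of the credal set, and alpha = 1 - P(p >= p x) in
    the upper one, gives
    Q(p = p x) <= P(p = p x).  As masses are untied on the support, the right
    hand side is p x, so q <= p pointwise, and both sum to 1. *)

Set Implicit Arguments.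
Unset Strict Implicit.
Unset Printing Implicit Defensive.

Import Order.TTheory GRing.Theory Num.Theory.
Local Open Scope classical_set_scope.
Local Open Scope ring_scope.

(** * Mass of finite events *)

Lemma Pr_mono (R : realType) (X : finType) (p : X -> R) (A B : pred X) :
  (forall x, 0 <= p x) -> (forall x, A x -> B x) -> Pr p A <= Pr p B.
Proof.
move=> p0 AB; rewrite /Pr [leRHS](bigID A) /=.
rewrite (eq_bigl A) ?lerDl ?sumr_ge0 // => x.
by have := AB x; case: (A x) => [->|_] //; rewrite andbF.
Qed.

Lemma Pr_ge0 (R : realType) (X : finType) (p : X -> R) (A : pred X) :
  (forall x, 0 <= p x) -> 0 <= Pr p A.
Proof. by move=> p0; apply: sumr_ge0. Qed.

Lemma Pr_le1 (R : realType) (X : finType) (p : X -> R) (A : pred X) :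
  prob_measures p -> Pr p A <= 1.
Proof. by move=> [p0 <-]; apply: (@Pr_mono _ _ _ _ xpredT). Qed.

Lemma PrC (R : realType) (X : finType) (p : X -> R) (A : pred X) :
  \sum_x p x = 1 -> Pr p (predC A) = 1 - Pr p A.
Proof. by move=> <-; rewrite /Pr [in RHS](bigID A) /= addrAC subrr add0r. Qed.

Lemma Pr_cover (R : realType) (X : finType) (p : X -> R) (A B : pred X) :
  prob_measures p -> (forall x, A x || B x) -> 1 <= Pr p A + Pr p B.
Proof.
move=> [p0 p1] AB; rewrite -lerBlDl -PrC //; apply: Pr_mono => // x /= nAx.
by have := AB x; rewrite (negPf nAx).
Qed.

Lemma prob_measures_inh (R : realType) (X : finType) (p : X -> R) :
  prob_measures p -> exists x : X, True.
Proof.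
move=> [_ p1]; case: (pickP (@predT X)) => [x _|X0]; first by exists x.
by move: p1; rewrite big_pred0 // => /eqP; rewrite eq_sym oner_eq0.
Qed.

(** * Functions dominating the mass of up-sets *)

(** A nonempty sublevel set of f lies in the up-set of its k-least element x,
    whose mass is at most f x, hence at most c.  The codomain of the key is an
    arbitrary total order so that the lemma also applies to the dual order, that
    is, to down-sets. *)
Lemma Pr_sublevel_le (R : realType) (X : finType) d (T : orderType d)
    (k : X -> T) (p f : X -> R) (c : R) :
  (forall x, 0 <= p x) -> 0 <= c ->
  (forall x, Pr p [pred y | (k x <= k y)%O] <= f x) ->
  Pr p [pred x | f x <= c] <= c.
Proof.
move=> p0 c0 pf; case: (pickP [pred x | f x <= c]) => [x0 fx0|f0]; last first.
  by rewrite /Pr big_pred0.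
have [x /= fx xmin] := @Order.TotalTheory.arg_minP _ _ _ x0 _ k fx0.
by apply: le_trans fx; apply: le_trans (pf x); apply: Pr_mono => // y /xmin.
Qed.

Lemma dominating_ge1 (R : realType) (X : finType) d (T : orderType d)
    (k : X -> T) (p f : X -> R) :
  prob_measures p -> (forall x, Pr p [pred y | (k x <= k y)%O] <= f x) ->
  exists x, 1 <= f x.
Proof.
move=> pp pf; have [x0 _] := prob_measures_inh pp.
have [x _ xmin] := @Order.TotalTheory.arg_minP _ _ _ x0 xpredT k isT.
exists x; apply: le_trans (pf x); case: pp => p0 <-.
by apply: (@Pr_mono _ _ _ xpredT) => // y _; apply: xmin.
Qed.

(** * Iterated suprema over linear extensions *)

(** The common shape of [pi_L] and [pi_delta_L], the event depending on the
    linear extension being a down-set or an up-set of the point considered. *)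
Definition sup_Pr (R : realType) (X : finType) (l u : X -> R)
    (A : rel X -> pred X) : R :=
  sup [set sup [set Pr p (A r) | p in feasible l u r]
      | r in linear_extensions l u].

(** Nonnegativity of the bound matters: for empty sets the supremum is 0. *)
Lemma sup_le_bound (R : realType) (S : set R) (c : R) :
  0 <= c -> (forall s, S s -> s <= c) -> sup S <= c.
Proof.
move=> c0 Sc; have [->|/set0P S0] := eqVneq S set0; first by rewrite sup0.
by apply: ge_sup.
Qed.

Lemma sup_Pr_le (R : realType) (X : finType) (l u : X -> R)
    (A : rel X -> pred X) (c : R) :
  0 <= c ->
  (forall r q, linear_extensions l u r -> feasible l u r q ->
    Pr q (A r) <= c) ->
  sup_Pr l u A <= c.
Proof.
move=> c0 Ac; apply: sup_le_bound => // _ [r rL <-].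
by apply: sup_le_bound => // _ [q qF <-]; apply: Ac.
Qed.

Lemma feasible_prob (R : realType) (X : finType) (l u : X -> R) (r : rel X)
    (q : X -> R) :
  (forall x, 0 <= l x) -> feasible l u r q -> prob_measures q.
Proof.
move=> l0 [q1 lqu _]; split=> // x.
by case/andP: (lqu x) => lq _; apply: le_trans lq.
Qed.

Lemma le_sup_Pr (R : realType) (X : finType) (l u : X -> R)
    (A : rel X -> pred X) (r : rel X) (p : X -> R) :
  (forall x, 0 <= l x) -> linear_extensions l u r -> feasible l u r p ->
  Pr p (A r) <= sup_Pr l u A.
Proof.
move=> l0 rL pF; have feas_le1 r' q : feasible l u r' q -> Pr q (A r') <= 1.
  by move=> /(feasible_prob l0)/Pr_le1.
apply: (@le_trans _ _ (sup [set Pr p (A r) | p in feasible l u r])).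
  by apply: ub_le_sup; [exists 1 => _ [q qF <-]; exact: feas_le1|exists p].
apply: ub_le_sup; last by exists r.
by exists 1 => _ [r' _ <-]; apply: sup_le_bound => // _ [q qF <-]; apply: feas_le1.
Qed.

(** * The linear extension adapted to a probability in the interval *)

Lemma rank_le (X : finType) (r : rel X) (x y : X) :
  total r -> transitive r -> (rank r x <= rank r y)%N -> r x y.
Proof.
move=> rt rtr; apply: contraLR => nrxy; rewrite -ltnNge.
have ryx : r y x by have := rt x y; rewrite (negPf nrxy).
apply: proper_card; apply/properP; split.
  by apply/fintype.subsetP => z; rewrite !inE => rzy; apply: rtr ryx.
by exists x; rewrite !inE //; have := rt x x; rewrite orbb.
Qed.

(** The mass comes first, so that p increases along the order; the midpoint
    makes the order compatible with the intervals when masses are tied; the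
    enumeration rank makes the order antisymmetric. *)
Definition mass_key (R : realType) (X : finType) (l u p : X -> R) (x : X) :
    R *l (R *l nat) :=
  (p x, (l x + u x, enum_rank x : nat)).

Definition mass_order (R : realType) (X : finType) (l u p : X -> R) : rel X :=
  fun x y => (mass_key l u p x <= mass_key l u p y)%O.

Lemma mass_orderE (R : realType) (X : finType) (l u p : X -> R) (x y : X) :
  mass_order l u p x y =
  (p x <= p y) && ((p y <= p x) ==> ((l x + u x <= l y + u y) &&
    ((l y + u y <= l x + u x) ==> (enum_rank x <= enum_rank y)%N))).
Proof. by []. Qed.

(** If u x <= l y and p x = p y, then u x = p x = l y, so both the lower and the
    upper ends are ordered as x, y; the two sums of ends can only be equal when
    the intervals coincide, in which case x and y are not strictly related. *)
Lemma mass_order_extension (R : realType) (X : finType) (l u p : X -> R) :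
  (forall x, l x <= p x <= u x) -> linear_extensions l u (mass_order l u p).
Proof.
move=> lpu; split.
- by move=> x y; apply: le_total.
- by move=> x y /le_anti [_ _ /ord_inj/enum_rank_inj].
- by move=> y x z; apply: le_trans.
move=> x y /andP[]; rewrite /le_L -ltNge mass_orderE => uxly lxuy.
have /andP[lx ux] := lpu x; have /andP[ly uy] := lpu y.
apply/andP; split; first lra.
apply/implyP => pyx; apply/andP; split; first lra.
by apply/implyP => myx; exfalso; lra.
Qed.

Lemma mass_order_feasible (R : realType) (X : finType) (l u p : X -> R) :
  interval_credal l u p -> feasible l u (mass_order l u p) p.
Proof.
move=> [[p0 p1] lpu]; split => // x y xy.
suff: mass_order l u p x y by rewrite mass_orderE => /andP[].
by apply: rank_le xy => [a b|b a c]; [apply: le_total|apply: le_trans].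
Qed.

Lemma Pr_down_le_pi_L (R : realType) (X : finType) (l u p : X -> R) (x : X) :
  prob_interval l u -> interval_credal l u p ->
  Pr p [pred y | (rank (mass_order l u p) y <= rank (mass_order l u p) x)%N]
    <= pi_L l u x.
Proof.
move=> [lu _] pL; have [_ lpu] := pL.
apply: (@le_sup_Pr _ _ l u (fun r => [pred y | (rank r y <= rank r x)%N])).
- by move=> y; case: (lu y).
- exact: mass_order_extension.
- exact: mass_order_feasible.
Qed.

Lemma Pr_up_le_pi_delta_L (R : realType) (X : finType) (l u p : X -> R)
    (x : X) :
  prob_interval l u -> interval_credal l u p ->
  Pr p [pred y | (rank (mass_order l u p) x <= rank (mass_order l u p) y)%N]
    <= pi_delta_L l u x.
Proof.
move=> [lu _] pL; have [_ lpu] := pL.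
apply: (@le_sup_Pr _ _ l u (fun r => [pred y | (rank r x <= rank r y)%N])).
- by move=> y; case: (lu y).
- exact: mass_order_extension.
- exact: mass_order_feasible.
Qed.

(** * The cloud and the outer approximation *)

Lemma pi_L_itv (R : realType) (X : finType) (l u : X -> R) (x : X) :
  prob_interval l u -> 0 <= pi_L l u x <= 1.
Proof.
move=> luP; have [lu [p pL]] := luP; apply/andP; split.
  apply: le_trans (Pr_down_le_pi_L x luP pL).
  by apply: Pr_ge0; case: pL => -[].
apply: (@sup_Pr_le _ _ l u (fun r => [pred y | (rank r y <= rank r x)%N])) => //.
by move=> r q _ qF; apply/Pr_le1/(feasible_prob _ qF) => y; case: (lu y).
Qed.

Lemma pi_delta_L_itv (R : realType) (X : finType) (l u : X -> R) (x : X) :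
  prob_interval l u -> 0 <= pi_delta_L l u x <= 1.
Proof.
move=> luP; have [lu [p pL]] := luP; apply/andP; split.
  apply: le_trans (Pr_up_le_pi_delta_L x luP pL).
  by apply: Pr_ge0; case: pL => -[].
apply: (@sup_Pr_le _ _ l u (fun r => [pred y | (rank r x <= rank r y)%N])) => //.
by move=> r q _ qF; apply/Pr_le1/(feasible_prob _ qF) => y; case: (lu y).
Qed.

Lemma cloud_L (R : realType) (X : finType) (l u : X -> R) :
  prob_interval l u -> is_cloud (delta_L l u) (pi_L l u).
Proof.
move=> luP; have [lu [p pL]] := luP; have [pp _] := pL.
set k := rank (mass_order l u p).
split=> [x|x|x||].
- by have /andP[d0 d1] := pi_delta_L_itv x luP; rewrite /delta_L; apply/andP; lra.
- exact: pi_L_itv.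
- rewrite /delta_L lerBlDr.
  apply: le_trans (lerD (Pr_down_le_pi_L x luP pL)
                        (Pr_up_le_pi_delta_L x luP pL)).
  by apply: Pr_cover => // y /=; apply: leq_total.
- have [x x1] := @dominating_ge1 _ _ _ (nat^d) k p _ pp
    (fun x => Pr_down_le_pi_L x luP pL).
  by exists x; apply/eqP; rewrite eq_le x1 andbT; case/andP: (pi_L_itv x luP).
- have [x x1] := @dominating_ge1 _ _ _ nat k p _ pp
    (fun x => Pr_up_le_pi_delta_L x luP pL).
  exists x; have /andP[_ d1] := pi_delta_L_itv x luP.
  by rewrite /delta_L; lra.
Qed.

Lemma interval_sub_cloud (R : realType) (X : finType) (l u : X -> R) :
  prob_interval l u ->
  interval_credal l u `<=` cloud_credal (delta_L l u) (pi_L l u).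
Proof.
move=> luP p pL; have [pp _] := pL; have [p0 p1] := pp.
set k := rank (mass_order l u p).
split=> // a /andP[a0 a1]; apply/andP; split.
  have a1' : 0 <= 1 - a by lra.
  have := @Pr_sublevel_le _ _ _ nat k p _ _ p0 a1'
    (fun x => Pr_up_le_pi_delta_L x luP pL).
  by apply: le_trans; apply: Pr_mono => // x /=; rewrite /delta_L; lra.
have pi_a := @Pr_sublevel_le _ _ _ (nat^d) k p _ _ p0 a0
  (fun x => Pr_down_le_pi_L x luP pL).
apply: (@le_trans _ _ (1 - Pr p [pred x | pi_L l u x <= a])); first lra.
by rewrite -PrC //; apply: Pr_mono => // x /=; rewrite -ltNge.
Qed.

(** * The precise case *)

Lemma prob_interval_precise (R : realType) (X : finType) (p : X -> R) :
  prob_measures p -> prob_interval p p.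
Proof.
move=> pp; have [p0 _] := pp; split; last by exists p; split=> // x; rewrite lexx.
move=> x; split=> //; split=> //; apply: le_trans (Pr_le1 (pred1 x) pp).
by rewrite /Pr big_pred1_eq.
Qed.

Lemma feasible_precise (R : realType) (X : finType) (p q : X -> R)
    (r : rel X) : feasible p p r q -> q = p.
Proof. by move=> [_ pqp _]; apply/funext => x; apply/esym/le_anti/pqp. Qed.

Lemma pi_L_precise_le (R : realType) (X : finType) (p : X -> R) (x : X) :
  prob_measures p -> pi_L p p x <= Pr p [pred y | p y <= p x].
Proof.
move=> [p0 _].
apply: (@sup_Pr_le _ _ p p (fun r => [pred y | (rank r y <= rank r x)%N])).
  exact: Pr_ge0.
move=> r q _ qF; have qp := feasible_precise qF; case: qF => _ _; rewrite qp => pm.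
by apply: Pr_mono => // y /=; apply: pm.
Qed.

Lemma pi_delta_L_precise_le (R : realType) (X : finType) (p : X -> R) (x : X) :
  prob_measures p -> pi_delta_L p p x <= Pr p [pred y | p x <= p y].
Proof.
move=> [p0 _].
apply: (@sup_Pr_le _ _ p p (fun r => [pred y | (rank r x <= rank r y)%N])).
  exact: Pr_ge0.
move=> r q _ qF; have qp := feasible_precise qF; case: qF => _ _; rewrite qp => pm.
by apply: Pr_mono => // y /=; apply: pm.
Qed.

Lemma Pr_level (R : realType) (X : finType) (p q : X -> R) (x : X) :
  \sum_y q y = 1 ->
  Pr q [pred y | p y == p x] =
  Pr q [pred y | p y <= p x] + Pr q [pred y | p x <= p y] - 1.
Proof.
move=> q1; rewrite (_ : Pr q [pred y | p x <= p y] =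
    1 - Pr q [pred y | p y < p x]); last first.
  by rewrite -PrC //; apply: eq_bigl => y /=; rewrite leNgt.
suff -> : Pr q [pred y | p y <= p x] =
    Pr q [pred y | p y == p x] + Pr q [pred y | p y < p x] by lra.
rewrite /Pr (bigID [pred y | p y == p x]) /=; congr (_ + _); apply: eq_bigl => y.
  by case: (ltgtP (p y) (p x)).
by case: (ltgtP (p y) (p x)).
Qed.

(** Let F and G be the masses under p of {p <= p x} and {p >= p x}.  On the first
    set pi <= F and on the second delta >= 1 - G, so the credal constraints at
    the thresholds F and 1 - G bound the masses under q of these two sets by F
    and G; their sum exceeds the mass of the level set {p = p x} by 1. *)
Lemma credal_level_le (R : realType) (X : finType) (p q : X -> R) (x : X) :
  prob_measures p -> cloud_credal (delta_L p p) (pi_L p p) q ->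
  Pr q [pred y | p y == p x] <= Pr p [pred y | p y == p x].
Proof.
move=> pp [[q0 q1] qC]; have [p0 p1] := pp; rewrite !Pr_level //.
set F := Pr p _; set G := Pr p _.
have F01 : 0 <= F <= 1 by rewrite Pr_ge0 ?Pr_le1.
have G01 : 0 <= 1 - G <= 1.
  by have := Pr_ge0 [pred y | p x <= p y] p0; have := Pr_le1 [pred y | p x <= p y] pp;
    rewrite -/G => ? ?; apply/andP; lra.
rewrite lerD2r; apply: lerD.
  have /andP[_ ] := qC _ F01.
  suff: Pr q [pred y | F < pi_L p p y] <= 1 - Pr q [pred y | p y <= p x] by lra.
  rewrite -PrC //; apply: Pr_mono => // y /=; apply: contraTN => pyx; rewrite -leNgt.
  apply: le_trans (pi_L_precise_le y pp) _; apply: Pr_mono => // z /= pzy.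
  exact: le_trans pyx.
have /andP[+ _] := qC _ G01; rewrite subKr; apply: le_trans.
apply: Pr_mono => // y /= pxy; rewrite /delta_L lerD2l lerN2.
apply: le_trans (pi_delta_L_precise_le y pp) _; apply: Pr_mono => // z /=.
exact: le_trans pxy.
Qed.

(** Ties are only possible at mass 0, where the whole level has mass 0. *)
Lemma Pr_level_untied (R : realType) (X : finType) (p : X -> R) (x : X) :
  (forall x, 0 <= p x) ->
  (forall x y, 0 < p x -> le_L p p x y -> le_L p p y x -> x = y) ->
  Pr p [pred y | p y == p x] = p x.
Proof.
move=> p0 untied; rewrite /Pr; have := p0 x; rewrite le_eqVlt => /orP[/eqP px0|px0].
  by rewrite -px0 big1 // => y /= /eqP.
rewrite (eq_bigl (pred1 x)) ?big_pred1_eq // => y /=; apply/eqP/eqP => [pyx|->//].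
by apply/esym/untied => //; rewrite /le_L pyx.
Qed.

Lemma dominated_prob_eq (R : realType) (X : finType) (p q : X -> R) :
  \sum_x p x = 1 -> \sum_x q x = 1 -> (forall x, q x <= p x) -> q = p.
Proof.
move=> p1 q1 qp; apply/funext => x; apply/esym/eqP; rewrite -subr_eq0.
have /eqP : \sum_x (p x - q x) = 0 by rewrite sumrB p1 q1 subrr.
rewrite psumr_eq0 => [/allP/(_ x)|y _]; last by rewrite subr_ge0.
by rewrite mem_index_enum; apply.
Qed.

Theorem proposition6 (R : realType) (X : finType) :
  (forall l u : X -> R, prob_interval l u ->
     is_cloud (delta_L l u) (pi_L l u) /\
     interval_credal l u `<=` cloud_credal (delta_L l u) (pi_L l u)) /\
  (forall p : X -> R, prob_measures p ->
     (forall x y, 0 < p x -> le_L p p x y -> le_L p p y x -> x = y) ->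
     cloud_credal (delta_L p p) (pi_L p p) = [set p]).
Proof.
split=> [l u luP|p pp untied].
  by split; [apply: cloud_L|apply: interval_sub_cloud].
have [p0 p1] := pp; apply/seteqP; split=> [q qC|_ ->].
  have [[q0 q1] _] := qC; apply: dominated_prob_eq => // x.
  rewrite -[leRHS](Pr_level_untied x p0 untied).
  apply: le_trans (credal_level_le x pp qC).
  rewrite (_ : q x = Pr q (pred1 x)); last by rewrite /Pr big_pred1_eq.
  by apply: (@Pr_mono _ _ _ (pred1 x)) => // y /= /eqP ->.
apply: interval_sub_cloud; first exact: prob_interval_precise.
by split=> // x; rewrite lexx.
Qed.
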